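(* Let $M$ be a linearly orderable (commutative) monoid, and let $\mathcal{P}_{\mathrm{fin}}(M)$ be its finitary power monoid. Then the following statements hold. (1) If $M$ is a Furstenberg monoid, then $\mathcal{P}_{\mathrm{fin}}(M)$ is a Furstenberg monoid. (2) If $M$ is quasi-Furstenberg, then $\mathcal{P}_{\mathrm{fin}}(M)$ is quasi-Furstenberg. (3) If $M$ is almost Furstenberg, then $\mathcal{P}_{\mathrm{fin}}(M)$ is almost Furstenberg. (4) If $M$ is nearly Furstenberg, then $\mathcal{P}_{\mathrm{fin}}(M)$ is nearly Furstenberg.
   Context: All monoids are commutative and written additively, with identity $0$. A monoid $M$ is linearly orderable if there is a total order $\preceq$ on $M$ such that $b \prec c$ implies $b+d \prec c+d$ for all $b,c,d \in M$. The finitary power monoid $\mathcal{P}_{\mathrm{fin}}(M)$ is the monoid of all nonempty finite subsets of $M$ under $S+T := \{s+t : s \in S, t \in T\}$. For a monoid $H$: $\mathcal{U}(H)$ is the group of invertible elements; $c \mid_H b$ means $b = c+d$ for some $d \in H$. An atom is an element $a \in H \setminus \mathcal{U}(H)$ such that $a = b+c$ with $b,c \in H$ implies $b \in \mathcal{U}(H)$ or $c \in \mathcal{U}(H)$; $\mathcal{A}(H)$ is the set of atoms. An element is atomic if it is invertible or a finite sum of atoms. $H$ is: - Furstenberg if every non-invertible element of $H$ is divisible by an atom; - nearly Furstenberg if there exists $c \in H$ such that for each non-invertible $b \in H$ there exists $a \in \mathcal{A}(H)$ with $a \mid_H b+c$ but $a \nmid_H c$; - quasi-Furstenberg (resp.,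 almost Furstenberg) if for each non-invertible $b \in H$ there exist $a \in \mathcal{A}(H)$ and an element (resp., an atomic element) $c \in H$ such that $a \mid_H b+c$ but $a \nmid_H c$. *)

(* Defs.v *)
From HB Require Import structures.
From mathcomp Require Import all_boot all_order all_algebra finmap.

Set Implicit Arguments.
Unset Strict Implicit.
Unset Printing Implicit Defensive.

Import GRing.Theory.
Local Open Scope fset_scope.
Local Open Scope ring_scope.

Section Monoid.
Variable H : nmodType.
Implicit Types a b c : H.

Definition invertible b : Prop := exists d : H, b + d = 0.

Definition divides c b : Prop := exists d : H, b = c + d.

Definition atom a : Prop :=
  ~ invertible a /\
  forall b c, a = b + c -> invertible b \/ invertible c.

Definition atomic b : Prop :=
  invertible b \/
  exists2 s : seq H, (forall a, a \in s -> atom a) & b = \sum_(a <- s) a.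

Definition Furstenberg : Prop :=
  forall b, ~ invertible b -> exists2 a, atom a & divides a b.

Definition nearly_Furstenberg : Prop :=
  exists c, forall b, ~ invertible b ->
    exists a, [/\ atom a, divides a (b + c) & ~ divides a c].

Definition quasi_Furstenberg : Prop :=
  forall b, ~ invertible b ->
    exists a c, [/\ atom a, divides a (b + c) & ~ divides a c].

Definition almost_Furstenberg : Prop :=
  forall b, ~ invertible b ->
    exists a c, [/\ atom a, atomic c, divides a (b + c) & ~ divides a c].

Definition linearly_orderable : Prop :=
  exists le : rel H,
    [/\ reflexive le, antisymmetric le, transitive le & total le] /\
    let lt b c := (b != c) && le b c in
    forall b c d : H, lt b c -> lt (b + d) (c + d).

End Monoid.

Record finpow (M : nmodType) : Type := FinPow {
  finpow_set :> {fset M};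
  finpow_neq0 : finpow_set != fset0
}.

HB.instance Definition _ (M : nmodType) := [isSub for @finpow_set M].
HB.instance Definition _ (M : nmodType) := [Choice of finpow M by <:].

Section FinitaryPowerMonoid.
Variable M : nmodType.
Implicit Types (A B C : {fset M}) (S T U : finpow M).

Definition sumset A B : {fset M} := [fset x + y | x in A, y in B].

Lemma sumsetP A B z :
  reflect (exists x y, [/\ x \in A, y \in B & z = x + y]) (z \in sumset A B).
Proof.
apply: (iffP (imfset2P _ _ _ _ _)) => [[x /= xA [y /= yB ->]]|[x [y [xA yB ->]]]].
  by exists x, y.
by exists x => //; exists y.
Qed.

Lemma sumset_neq0 A B : A != fset0 -> B != fset0 -> sumset A B != fset0.
Proof.
move=> /fset0Pn[x xA] /fset0Pn[y yB]; apply/fset0Pn; exists (x + y).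
by apply/sumsetP; exists x, y.
Qed.

Lemma fset1_neq0 (x : M) : [fset x] != fset0.
Proof. by apply/fset0Pn; exists x; rewrite in_fset1. Qed.

Definition finpow_zero : finpow M := FinPow (fset1_neq0 0).

Definition finpow_add S T : finpow M :=
  FinPow (sumset_neq0 (finpow_neq0 S) (finpow_neq0 T)).

Lemma finpow_addA : associative finpow_add.
Proof.
move=> S T U; apply/val_inj/fsetP => z /=; apply/sumsetP/sumsetP.
  move=> [x [_ [xS /sumsetP[y [t [yT tU ->]]] ->]]].
  exists (x + y), t; split; rewrite ?addrA //.
  by apply/sumsetP; exists x, y.
move=> [_ [t [/sumsetP[x [y [xS yT ->]]] tU ->]]].
exists x, (y + t); split; rewrite ?addrA //.
by apply/sumsetP; exists y, t.
Qed.

Lemma finpow_addC : commutative finpow_add.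
Proof.
move=> S T; apply/val_inj/fsetP => z /=.
by apply/sumsetP/sumsetP => -[x [y [xS yT ->]]]; exists y, x; rewrite addrC.
Qed.

Lemma finpow_add0 : left_id finpow_zero finpow_add.
Proof.
move=> S; apply/val_inj/fsetP => z /=; apply/sumsetP/idP.
  by move=> [x [y [/fset1P-> yS ->]]]; rewrite add0r.
by move=> zS; exists 0, z; rewrite in_fset1 eqxx add0r.
Qed.

HB.instance Definition _ :=
  GRing.isNmodule.Build (finpow M) finpow_addA finpow_addC finpow_add0.

End FinitaryPowerMonoid.

(* Main.v *)
Require Import Defs.
From mathcomp Require Import all_boot all_order all_algebra finmap.
From Stdlib Require Import Classical.

(** A property of finite nonempty sets that passes from a set to its multiples,
    and that holds for non-invertible singletons and for atoms with at least two
    elements, holds for every non-invertible set: in a linearly ordered monoid,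
    adding a set with at least two elements strictly increases the cardinality,
    so factoring non-atoms terminates.  Each of the four Furstenberg conditions
    has this form, with the complement [c] of the base monoid lifted to the
    singleton [{c}] and, for atoms with at least two elements, with the atom
    itself as the witness. *)

Set Implicit Arguments.
Unset Strict Implicit.
Unset Printing Implicit Defensive.

Import GRing.Theory.
Local Open Scope fset_scope.
Local Open Scope ring_scope.

Lemma exists_greatest (T : eqType) (le : rel T) (x : T) (s : seq T) :
  reflexive le -> transitive le -> total le -> x \in s ->
  exists2 m, m \in s & forall y, y \in s -> le y m.
Proof.
move=> le_refl le_trans le_total; elim: s x => // a [|b s] IHs x _.
  by exists a => [|y]; rewrite inE ?eqxx // => /eqP->.
have [m ms mP] := IHs b (mem_head b s).
have [le_am|le_ma] := orP (le_total a m).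
  exists m => [|y]; first by rewrite inE ms orbT.
  by rewrite inE => /predU1P[->|/mP].
exists a => [|y]; first exact: mem_head.
by rewrite inE => /predU1P[->|/mP le_ym]; last exact: le_trans le_ma.
Qed.

Lemma not_atom_split (H : nmodType) (b : H) :
  ~ invertible b -> ~ atom b ->
  exists c d, [/\ b = c + d, ~ invertible c & ~ invertible d].
Proof.
move=> nb natom; apply: NNPP => nsplit; apply: natom; split=> // c d b_cd.
apply: NNPP => /not_or_and[nc nd].
by apply: nsplit; exists c, d.
Qed.

Section Divisibility.
Variable H : nmodType.
Implicit Types a b c d : H.

Lemma divides_addr a b c : divides a b -> divides a (b + c).
Proof. by move=> [d ->]; exists (d + c); rewrite addrA. Qed.

(** This carries a witness from [b] to its multiple [b + c]: the same atom [a] and the same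
    complement [d] still serve. *)
Lemma divides_addAC a b c d : divides a (b + d) -> divides a (b + c + d).
Proof. by rewrite addrAC; exact: divides_addr. Qed.

End Divisibility.

Definition singleton (M : nmodType) (x : M) : finpow M := FinPow (fset1_neq0 x).
Arguments singleton {M} x.

(** * Singletons as a copy of the base monoid in its power monoid *)

Section Singleton.
Variable M : nmodType.
Implicit Types (a b c x y : M) (S T U : finpow M).

Lemma finpow_ex S : exists x, x \in finpow_set S.
Proof. exact/fset0Pn/finpow_neq0. Qed.

Lemma finpow_addP S T x :
  reflect (exists y z, [/\ y \in finpow_set S, z \in finpow_set T & x = y + z])
          (x \in finpow_set (S + T)).
Proof. exact: sumsetP. Qed.

Lemma in_singleton x y : (y \in finpow_set (singleton x)) = (y == x).
Proof. exact: in_fset1. Qed.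

Lemma singleton0 : singleton 0 = 0 :> finpow M.
Proof. exact: val_inj. Qed.

Lemma singletonD x y : singleton (x + y) = singleton x + singleton y.
Proof.
apply/val_inj/fsetP => z; rewrite in_singleton.
apply/eqP/finpow_addP => [->|[_ [_ [/fset1P-> /fset1P-> ->]]] //].
by exists x, y; rewrite !in_singleton.
Qed.

Lemma singleton_inj : injective (@singleton M).
Proof. by move=> x y /(congr1 val)/fset1_inj. Qed.

Lemma card_singleton x : #|` singleton x| = 1%N.
Proof. exact: cardfs1. Qed.

Lemma card_finpow_gt0 S : (0 < #|` S|)%N.
Proof. by rewrite cardfs_gt0 finpow_neq0. Qed.

Lemma card1_singleton S : (#|` S| <= 1)%N -> exists x, S = singleton x.
Proof.
move=> S1; have /eqP/cardfs1P[x Sx] : #|` S| = 1%N.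
  by apply/eqP; rewrite eqn_leq S1 card_finpow_gt0.
by exists x; apply: val_inj.
Qed.

Lemma sum_singleton (s : seq M) :
  singleton (\sum_(a <- s) a) = \sum_(A <- map singleton s) A.
Proof.
rewrite big_map; elim: s => [|a s IHs]; first by rewrite !big_nil singleton0.
by rewrite !big_cons singletonD IHs.
Qed.

(** Any element of a set inverse to [{x}] is itself an inverse of [x]. *)
Lemma invertible_singleton x : invertible (singleton x) <-> invertible x.
Proof.
split=> [[T xT0]|[y xy0]]; last by exists (singleton y); rewrite -singletonD xy0 singleton0.
have [y yT] := finpow_ex T; exists y.
apply/eqP; rewrite -in_singleton singleton0 -xT0.
by apply/finpow_addP; exists x, y; rewrite in_singleton.
Qed.

Lemma divides_singletonW a b :
  divides a b -> divides (singleton a) (singleton b).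
Proof. by move=> [d ->]; exists (singleton d); rewrite singletonD. Qed.

End Singleton.

(** * Cardinality of sumsets and factorizations under a linear order *)

Section LinearlyOrdered.
Variables (M : nmodType) (hM : linearly_orderable M).
Implicit Types (a b c x y : M) (S T U : finpow M).

(** Distinct elements are strictly comparable, and translation preserves strict comparison, so it
    cannot identify them. *)
Lemma linearly_orderable_addIr x : injective (fun y => y + x).
Proof.
have [le [[_ _ _ le_total] ltD]] := hM.
move=> y z /= eq_yz; apply/eqP/negPn/negP => ne_yz.
have [le_yz|le_zy] := orP (le_total y z).
  by have := ltD y z x; rewrite ne_yz le_yz eq_yz eqxx => /(_ isT).
by have := ltD z y x; rewrite eq_sym ne_yz le_zy eq_yz eqxx => /(_ isT).
Qed.

Lemma card_translate x S : #|` [fset y + x | y in finpow_set S]| = #|` S|.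
Proof. exact/card_imfset/linearly_orderable_addIr. Qed.

(** The sumset contains a translate [S + t], which by cancellation has as many elements as [S]. *)
Lemma leq_card_finpowD S T : (#|` S| <= #|` (S + T)%R|)%N.
Proof.
have [t tT] := finpow_ex T.
rewrite -(card_translate t).
apply/fsubset_leq_card/fsubsetP => _ /imfsetP[s /= sS ->].
by apply/finpow_addP; exists s, t.
Qed.

(* If [t < t'] lie in [T] and [m] is the greatest element of [S], then [m + t']
   lies in [S + T] but exceeds every element of the translate [S + t]. *)
Lemma ltn_card_finpowD S T : (1 < #|` T|)%N -> (#|` S| < #|` (S + T)%R|)%N.
Proof.
move=> T_gt1; have [le [[le_refl le_anti le_trans le_total] ltD]] := hM.
have [t [t' [tT t'T ne_tt' le_tt']]] :
    exists t t', [/\ t \in finpow_set T, t' \in finpow_set T, t != t' & le t t'].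
  have [t tT] := finpow_ex T.
  have /fset0Pn[t'] : (T : {fset M}) `\ t != fset0.
    by rewrite -cardfs_gt0; move: T_gt1; rewrite (cardfsD1 t) tT.
  rewrite in_fsetD1 => /andP[ne_t't t'T].
  have [le_tt'|le_t't] := orP (le_total t t'); first by exists t, t'; rewrite eq_sym.
  by exists t', t.
have [s sS] := finpow_ex S.
have [m mS mP] := exists_greatest le_refl le_trans le_total sS.
rewrite -(card_translate t).
apply: fproper_ltn_card; rewrite fproperE; apply/andP; split.
  by apply/fsubsetP => _ /imfsetP[x /= xS ->]; apply/finpow_addP; exists x, t.
apply/fsubsetPn; exists (m + t'); first by apply/finpow_addP; exists m, t'.
apply/negP => /imfsetP[x /= xS eq_mx].
(* Since [m + t' = x + t], the inequality [t < t'] gives [m + t < x + t]; in particular [x != m], so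
   [x < m] by maximality and [x + t < m + t], a contradiction. *)
have /(ltD _ _ m) : (t != t') && le t t' by rewrite ne_tt'.
rewrite ![_ + m]addrC eq_mx => /andP[ne_mx le_mx].
have ne_xm : x != m by apply: contraNneq ne_mx => ->.
have /(ltD _ _ t)/andP[_ le_xm] : (x != m) && le x m by rewrite ne_xm mP.
by case/eqP: ne_mx; apply: le_anti; rewrite le_mx.
Qed.

(** A summand never has more elements than the sum, so a singleton factors only into singletons. *)
Lemma singleton_eqD x S T :
  singleton x = S + T ->
  exists y z, [/\ S = singleton y, T = singleton z & x = y + z].
Proof.
move=> xST; have := leq_card_finpowD S T; have := leq_card_finpowD T S.
rewrite [T + S]addrC -xST card_singleton.
move=> /card1_singleton[z Tz] /card1_singleton[y Sy].
by exists y, z; split=> //; apply: singleton_inj; rewrite singletonD -Sy -Tz.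
Qed.

Lemma divides_singleton_singleton S x :
  divides S (singleton x) -> exists2 y, S = singleton y & divides y x.
Proof. by move=> [T /singleton_eqD[y [z [-> _ ->]]]]; exists y => //; exists z. Qed.

Lemma divides_singleton a b :
  divides (singleton a) (singleton b) <-> divides a b.
Proof.
split=> [|/divides_singletonW //].
by move=> /divides_singleton_singleton[y /singleton_inj->].
Qed.

(** Every factorization of [{a}] comes from a factorization of [a]. *)
Lemma atom_singleton a : atom a -> atom (singleton a).
Proof.
move=> [na split_a]; split=> [/invertible_singleton //|S T].
move=> /singleton_eqD[y [z [-> -> /split_a]]].
by rewrite !invertible_singleton.
Qed.

Lemma atomic_singleton c : atomic c -> atomic (singleton c).
Proof.
move=> [c_inv|[s s_atom ->]]; first by left; apply/invertible_singleton.
right; exists (map singleton s); last exact: sum_singleton.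
by move=> _ /mapP[a /s_atom/atom_singleton ? ->].
Qed.

Lemma finpow_noninvertible_ind (P : finpow M -> Prop) :
  (forall S T, P S -> P (S + T)) ->
  (forall x, ~ invertible x -> P (singleton x)) ->
  (forall S, atom S -> (1 < #|` S|)%N -> P S) ->
  forall S, ~ invertible S -> P S.
Proof.
move=> PD P1 Patom S; have [n] := ubnP #|` S|.
elim: n S => // n IHn S S_le nS.
have Psmall T : (#|` T| <= 1)%N -> ~ invertible T -> P T.
  by move=> /card1_singleton[x ->]; rewrite invertible_singleton; apply: P1.
have [S_le1|S_gt1] := leqP #|` S| 1; first exact: Psmall.
have [/Patom|natom] := classic (atom S); first exact.
have [T [U [S_TU nT nU]]] := not_atom_split nS natom.
have [U_le1|U_gt1] := leqP #|` U| 1.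
  by rewrite S_TU addrC; apply/PD/Psmall.
rewrite S_TU; apply/PD/IHn => //.
by have := ltn_card_finpowD T U_gt1; rewrite -S_TU => /leq_trans; apply.
Qed.

(** This lets an atom with at least two elements be its own witness, whichever singleton is the
    complement. *)
Lemma not_divides_singleton S x : (1 < #|` S|)%N -> ~ divides S (singleton x).
Proof. by move=> S_gt1 /divides_singleton_singleton[y Sy]; rewrite Sy card_singleton in S_gt1. Qed.

(** * Transfer of the four Furstenberg conditions *)

Lemma finpow_Furstenberg : Furstenberg M -> Furstenberg (finpow M).
Proof.
move=> FM; apply: finpow_noninvertible_ind => [S T [A A_atom AS]|x /FM[a a_atom ax]|S S_atom _].
- by exists A => //; apply: divides_addr.
- by exists (singleton a); [apply: atom_singleton | apply/divides_singleton].
- by exists S => //; exists 0; rewrite addr0.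
Qed.

Lemma finpow_quasi_Furstenberg :
  quasi_Furstenberg M -> quasi_Furstenberg (finpow M).
Proof.
move=> QM; apply: finpow_noninvertible_ind
  => [S T [A [C [A_atom ASC nAC]]]|x /QM[a [c [a_atom axc nac]]]|S S_atom S_gt1].
- by exists A, C; split=> //; apply: divides_addAC.
- exists (singleton a), (singleton c).
  by split; rewrite -?singletonD ?divides_singleton //; apply: atom_singleton.
- exists S, (singleton 0); split=> //; last exact: not_divides_singleton.
  by exists (singleton 0).
Qed.

Lemma finpow_almost_Furstenberg :
  almost_Furstenberg M -> almost_Furstenberg (finpow M).
Proof.
move=> AM; apply: finpow_noninvertible_ind
  => [S T [A [C [A_atom C_atomic ASC nAC]]]|x /AM[a [c [a_atom c_atomic axc nac]]]|S S_atom S_gt1].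
- by exists A, C; split=> //; apply: divides_addAC.
- exists (singleton a), (singleton c).
  split; rewrite -?singletonD ?divides_singleton //; first exact: atom_singleton.
  exact: atomic_singleton.
- exists S, (singleton 0); split=> //; last exact: not_divides_singleton.
    (* The complement [{0}] is atomic because it is invertible. *)
    by apply/atomic_singleton; left; exists 0; rewrite addr0.
  by exists (singleton 0).
Qed.

Lemma finpow_nearly_Furstenberg :
  nearly_Furstenberg M -> nearly_Furstenberg (finpow M).
Proof.
move=> [c cP]; exists (singleton c); apply: finpow_noninvertible_ind
  => [S T [A [A_atom ASc nAc]]|x /cP[a [a_atom axc nac]]|S S_atom S_gt1].
- by exists A; split=> //; apply: divides_addAC.
- exists (singleton a).
  by split; rewrite -?singletonD ?divides_singleton //; apply: atom_singleton.
(* The complement [{c}] was fixed beforehand, but as a singleton it is divisible by no atom with at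
   least two elements. *)
- exists S; split=> //; last exact: not_divides_singleton.
  by exists (singleton c).
Qed.

End LinearlyOrdered.

Theorem theorem6p2 (M : nmodType) (hM : linearly_orderable M) :
  [/\ Furstenberg M -> Furstenberg (finpow M),
      quasi_Furstenberg M -> quasi_Furstenberg (finpow M),
      almost_Furstenberg M -> almost_Furstenberg (finpow M)
    & nearly_Furstenberg M -> nearly_Furstenberg (finpow M)].
Proof.
split.
- exact: finpow_Furstenberg.
- exact: finpow_quasi_Furstenberg.
- exact: finpow_almost_Furstenberg.
- exact: finpow_nearly_Furstenberg.
Qed.
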